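(* (Soundness) For every set $\Gamma\cup\{\phi\}$ of $\mathcal{L}^+$-sentences: if $\Gamma\vdash\phi$ (i.e. $\phi$ is derivable from $\Gamma$ in $\mathcal{N}\mathsf{BQL}_{\mathsf{CD}}^r$) then $\Gamma\models\phi$.
   Context: Language. $\mathcal{L}$ is an arbitrary first-order language with primitive operators $\top,\bot,\wedge,\vee,\rightarrow,\forall,\exists$ (identity, if present, is a non-logical relation symbol), and $\mathcal{L}^+=\mathcal{L}\cup\{a_i:i\in\omega\}$ with each $a_i$ a fresh constant symbol. $\phi(t)$ is the result of substituting the closed term $t$ for the variable $v$ in $\phi$. Proof system. $\mathcal{N}\mathsf{BQL}_{\mathsf{CD}}^r$ consists of all finite trees of (possibly discharged) $\mathcal{L}^+$-sentences (leaves are open assumptions unless discharged) built by the rules: $\top$-Int: $\top$ may be used as a leaf that counts as discharged. $\bot$-Elim: from $\bot$ infer $\phi$. $\wedge$-Int: from $\phi$ and $\psi$ infer $\phi\wedge\psi$. $\wedge$-Elim: from $\phi\wedge\psi$ infer $\phi$; likewise $\psi$. $\vee$-Int: from $\phi$ infer $\phi\vee\psi$; likewise from $\psi$. $\vee$-Elim: from $\phi\vee\psi$, a subproof of $\chi$ (discharging $\phi$) and a subproof of $\chi$ (discharging $\psi$), infer $\chi$. $\rightarrow$-Int: from a subproof of $\psi$ (discharging $\phi$) infer $\phi\rightarrow\psi$. $\rightarrow$-Elim: from $\phi$ (left premise) and $\phi\rightarrow\psi$ (right premise) infer $\psi$. Internal Transitivity: from $\phi\rightarrow\psi$ and $\psi\rightarrow\chi$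 infer $\phi\rightarrow\chi$. Internal $\wedge$-Int: from $\phi\rightarrow\psi$ and $\phi\rightarrow\chi$ infer $\phi\rightarrow\psi\wedge\chi$. Internal $\vee$-Elim: from $\phi\rightarrow\chi$ and $\psi\rightarrow\chi$ infer $\phi\vee\psi\rightarrow\chi$. Internal $\forall$-Int: from $\forall v(\phi\rightarrow\psi)$ infer $\phi\rightarrow\forall v\psi$. Internal $\exists$-Elim: from $\forall v(\phi\rightarrow\psi)$ infer $\exists v\phi\rightarrow\psi$. $\forall$-Int: from $\phi(a_i)$ infer $\forall v\phi$. $\forall$-Elim: from $\forall v\phi$ infer $\phi(t)$. CD: from $\forall v(\phi\vee\psi)$ infer $\phi\vee\forall v\psi$. $\exists$-Int: from $\phi(t)$ infer $\exists v\phi$. $\exists$-Elim: from $\exists v\phi$ and a subproof of $\psi$ (discharging $\phi(a_i)$) infer $\psi$. Restrictions: (C1) only sentences occur in proofs (so, e.g., $\phi$ has no free variables in CD); (C2) in $\forall$-Int, $a_i$ may not occur in $\phi$ or in any open assumption of the subproof of $\phi(a_i)$; (C3) in $\exists$-Elim, $a_i$ may not occur in $\phi$, $\psi$ or any open assumption other than $\phi(a_i)$ of the subproof of $\psi$; (C4) in $\exists$-Elim all open occurrences of $\phi(a_i)$ in the subproof of $\psi$ must be discharged, while in the other discharging rules any number (including zero) of open occurrences of the indicated assumption may be discharged; (C5) no unsafe occurrence of an open assumption may be discharged, where an occurrence of a (possibly discharged) assumption at a leaf is unsafe in a proof if it lies in the subtree ending in the right premise $\alpha\rightarrow\beta$ of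 some application of $\rightarrow$-Elim (including the case where the leaf is that premise itself). $\Gamma\vdash\phi$ iff there is such a proof with root $\phi$ whose open assumptions all belong to $\Gamma$. Semantics. For a first-order language $\mathcal{K}$, a $\mathcal{K}$-model is $\mathfrak{M}=\langle W,\prec,M,|\cdot|\rangle$ with $W$ a non-empty set of worlds, $\prec$ a transitive relation on $W$ (not necessarily reflexive), $M$ a non-empty set, and $|\cdot|$ an interpretation with $|c|\in M$, $|f^n|:M^n\to M$, $|R^n|:W\to\mathcal{P}(M^n)$, such that $w\prec u$ implies $|R^n|(w)\subseteq|R^n|(u)$. Terms denote as usual. Satisfaction $w\Vdash\phi(\overline{a})$: atomic formulas $R^n(\overline{t})$ hold at $w$ iff the tuple of denotations is in $|R^n|(w)$; $\top$ always holds and $\bot$ never; $\wedge,\vee$ are evaluated locally at $w$; $w\Vdash(\phi\rightarrow\psi)(\overline{a})$ iff for all $u$ with $w\prec u$, $u\Vdash\phi(\overline{a})$ implies $u\Vdash\psi(\overline{a})$; $w\Vdash\exists v\phi(\overline{a})$ (resp. $\forall v\phi(\overline{a})$) iff $w\Vdash\phi(\overline{a},b)$ for some (resp. all) $b\in M$. $w$ is reflexive if $w\prec w$. For $\mathcal{L}^+$-sentences, $\Gamma\models\phi$ iff for every $\mathcal{L}^+$-model and every reflexive world $w$ in it, if $w$ satisfies all of $\Gamma$ then $w\Vdash\phi$. *)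

(* Defs.v *)
From mathcomp Require Import all_boot.
From Stdlib Require List.

Set Implicit Arguments.
Unset Strict Implicit.
Unset Printing Implicit Defensive.

Record language := Language {
  const : Type;
  func : Type;
  far : func -> nat;
  rel : Type;
  rar : rel -> nat }.

(* [inr i] is the fresh constant a_i. *)
Definition plus (L : language) : language :=
  {| const := const L + nat; func := func L; far := @far L;
     rel := rel L; rar := @rar L |}.

Section Syntax.
Variable K : language.

(* Named variables; [T ^ n] is [{ffun 'I_n -> T}]. *)
Inductive term : Type :=
| Var of nat
| Cst of const K
| App (f : func K) of term ^ far f.

Inductive form : Type :=
| Top
| Bot
| Atom (R : rel K) of term ^ rar R
| And of form & form
| Or of form & form
| Imp of form & form
| All of nat & form
| Ex of nat & form.

Fixpoint tfree (v : nat) (t : term) : Prop :=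
  match t with
  | Var x => x = v
  | Cst _ => False
  | App f ts => exists i, tfree v (ts i)
  end.

Fixpoint free (v : nat) (A : form) : Prop :=
  match A with
  | Top | Bot => False
  | Atom R ts => exists i, tfree v (ts i)
  | And B C | Or B C | Imp B C => free v B \/ free v C
  | All x B | Ex x B => x <> v /\ free v B
  end.

Definition tclosed (t : term) : Prop := forall v, ~ tfree v t.
Definition sentence (A : form) : Prop := forall v, ~ free v A.

Fixpoint tsubst (v : nat) (t u : term) : term :=
  match u with
  | Var x => if x == v then t else Var x
  | Cst c => Cst c
  | App f us => App [ffun i => tsubst v t (us i)]
  end.

(* No renaming of bound variables: [subst v t] is only ever used with [t]
   closed, so that no capture can occur. *)
Fixpoint subst (v : nat) (t : term) (A : form) : form :=
  match A with
  | Top => Top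
  | Bot => Bot
  | Atom R ts => Atom [ffun i => tsubst v t (ts i)]
  | And B C => And (subst v t B) (subst v t C)
  | Or B C => Or (subst v t B) (subst v t C)
  | Imp B C => Imp (subst v t B) (subst v t C)
  | All x B => All x (if x == v then B else subst v t B)
  | Ex x B => Ex x (if x == v then B else subst v t B)
  end.

Fixpoint toccurs (c : const K) (t : term) : Prop :=
  match t with
  | Var _ => False
  | Cst d => d = c
  | App f ts => exists i, toccurs c (ts i)
  end.

Fixpoint occurs (c : const K) (A : form) : Prop :=
  match A with
  | Top | Bot => False
  | Atom R ts => exists i, toccurs c (ts i)
  | And B C | Or B C | Imp B C => occurs c B \/ occurs c C
  | All _ B | Ex _ B => occurs c B
  end.

End Syntax.

Arguments Top {K}.
Arguments Bot {K}.
Arguments Var {K} _.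

Section Proofs.
Variable L : language.
Local Notation form := (form (plus L)).

Definition fresh_const (i : nat) : const (plus L) := inr i.
Definition fresh_term (i : nat) : term (plus L) := Cst (fresh_const i).

Inductive rule1 : form -> form -> Prop :=
| BotE A : rule1 Bot A
| AndE1 A B : rule1 (And A B) A
| AndE2 A B : rule1 (And A B) B
| OrI1 A B : rule1 A (Or A B)
| OrI2 A B : rule1 B (Or A B)
| IntAllI v A B : rule1 (All v (Imp A B)) (Imp A (All v B))
| IntExE v A B : rule1 (All v (Imp A B)) (Imp (Ex v A) B)
| AllE v A t : tclosed t -> rule1 (All v A) (subst v t A)
| CD v A B : rule1 (All v (Or A B)) (Or A (All v B))
| ExI v A t : tclosed t -> rule1 (subst v t A) (Ex v A).

Inductive rule2 : form -> form -> form -> Prop :=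
| AndI A B : rule2 A B (And A B)
| IntTrans A B C : rule2 (Imp A B) (Imp B C) (Imp A C)
| IntAndI A B C : rule2 (Imp A B) (Imp A C) (Imp A (And B C))
| IntOrE A B C : rule2 (Imp A C) (Imp B C) (Imp (Or A B) C).

(* The occurrence of an assumption at a leaf of a proof. *)
Record leaf := Leaf { fml : form; discharged : bool; unsafe : bool }.

Definition is_open (l : leaf) : Prop := discharged l = false.

Definition mark_unsafe (l : leaf) : leaf := Leaf (fml l) (discharged l) true.

(* [discharge A ls ls']: [ls'] arises from [ls] by discharging any number of
   the safe open occurrences of [A]. *)
Definition discharge (A : form) : seq leaf -> seq leaf -> Prop :=
  List.Forall2 (fun l l' =>
    l' = l \/ l = Leaf A false false /\ l' = Leaf A true false).

(* An inhabitant of [proof ls A] is a proof tree with root [A] and leaves [ls],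
   listed from left to right with their status in that tree.  An application of
   a discharging rule looks at the status that leaves have in the subproof
   ending at its premise: a leaf that is safe there may be discharged even if
   a later application of implication elimination makes it unsafe. *)
Inductive proof : seq leaf -> form -> Type :=
| Assume A : sentence A -> proof [:: Leaf A false false] A
| TopI : proof [:: Leaf Top true false] Top
| Step1 ls A B :
    rule1 A B -> sentence B -> proof ls A -> proof ls B
| Step2 ls1 ls2 A B C :
    rule2 A B C -> sentence C ->
    proof ls1 A -> proof ls2 B -> proof (ls1 ++ ls2) C
| ImpE ls1 ls2 A B :
    proof ls1 A -> proof ls2 (Imp A B) ->
    proof (ls1 ++ map mark_unsafe ls2) B
| ImpI ls ls' A B :
    sentence (Imp A B) ->
    proof ls B -> discharge A ls ls' -> proof ls' (Imp A B)
| OrE ls ls1 ls1' ls2 ls2' A B C :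
    proof ls (Or A B) ->
    proof ls1 C -> discharge A ls1 ls1' ->
    proof ls2 C -> discharge B ls2 ls2' ->
    proof (ls ++ ls1' ++ ls2') C
| AllI ls v A i :
    sentence (All v A) ->
    proof ls (subst v (fresh_term i) A) ->
    ~ occurs (fresh_const i) A ->
    (forall l, List.In l ls -> is_open l -> ~ occurs (fresh_const i) (fml l)) ->
    proof ls (All v A)
| ExE ls ls1 ls1' v A i B :
    proof ls (Ex v A) ->
    proof ls1 B ->
    ~ occurs (fresh_const i) A ->
    ~ occurs (fresh_const i) B ->
    (forall l, List.In l ls1 -> is_open l ->
       fml l <> subst v (fresh_term i) A -> ~ occurs (fresh_const i) (fml l)) ->
    discharge (subst v (fresh_term i) A) ls1 ls1' ->
    (forall l, List.In l ls1' -> is_open l ->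
       fml l <> subst v (fresh_term i) A) ->
    proof (ls ++ ls1') B.

Definition derivable (Gamma : form -> Prop) (A : form) : Prop :=
  exists (ls : seq leaf) (_ : proof ls A),
    forall l, List.In l ls -> is_open l -> Gamma (fml l).

End Proofs.

Record model (K : language) := Model {
  world : Type;
  world_inh : inhabited world;
  prec : world -> world -> Prop;
  prec_trans : forall w u x, prec w u -> prec u x -> prec w x;
  dom : Type;
  dom_inh : inhabited dom;
  icst : const K -> dom;
  ifun : forall f : func K, dom ^ far f -> dom;
  irel : forall R : rel K, world -> dom ^ rar R -> Prop;
  irel_mono : forall (R : rel K) w u, prec w u ->
    forall ds : dom ^ rar R, irel w ds -> irel u ds }.

Section Semantics.
Variables (K : language) (M : model K).

Definition update (s : nat -> dom M) (v : nat) (b : dom M) : nat -> dom M :=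
  fun x => if x == v then b else s x.

Fixpoint denote (s : nat -> dom M) (t : term K) : dom M :=
  match t with
  | Var x => s x
  | Cst c => icst M c
  | App f ts => ifun [ffun i => denote s (ts i)]
  end.

Fixpoint sat (w : world M) (s : nat -> dom M) (A : form K) : Prop :=
  match A with
  | Top => True
  | Bot => False
  | Atom R ts => irel w [ffun i => denote s (ts i)]
  | And B C => sat w s B /\ sat w s C
  | Or B C => sat w s B \/ sat w s C
  | Imp B C => forall u, prec w u -> sat u s B -> sat u s C
  | All v B => forall b, sat w (update s v b) B
  | Ex v B => exists b, sat w (update s v b) B
  end.

(* Truth of a sentence, for which the choice of [s] is immaterial. *)
Definition holds (w : world M) (A : form K) : Prop := forall s, sat w s A.

Definition reflexive_world (w : world M) : Prop := prec w w.

End Semantics.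

Definition entails (L : language) (Gamma : form (plus L) -> Prop)
    (A : form (plus L)) : Prop :=
  forall (M : model (plus L)) (w : world M), reflexive_world w ->
    (forall B, Gamma B -> holds w B) -> holds w A.

(* Main.v *)
(** Evaluating a proof at a single world fails: at irreflexive worlds
    implication elimination is unsound, and implication introduction leads from
    a reflexive world to worlds that need not be reflexive.  The invariant
    therefore involves two worlds, a reflexive [w] and some [u] above it: if the
    unsafe open assumptions hold at [w] and the safe ones at [u], then the
    conclusion holds at [u].  For implication elimination the right premise is
    evaluated at the pair [w], [w], so that the implication holds at [w] and can
    be applied at [u].  Discharged assumptions are safe, so that for implication
    introduction it suffices to move [u] upwards. *)
From mathcomp Require Import all_boot.
From Stdlib Require Import Classical.
From Stdlib Require List.
Require Import Defs.

Set Implicit Arguments.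
Unset Strict Implicit.
Unset Printing Implicit Defensive.

(* The generated [term_ind] gives no hypothesis for the arguments of [App],
   which are nested in a finite function. *)
Fixpoint term_nested_ind (K : language) (P : term K -> Prop)
    (HV : forall x, P (Var x)) (HC : forall c, P (Cst c))
    (HA : forall f (ts : term K ^ far f), (forall i, P (ts i)) -> P (App ts))
    (t : term K) : P t :=
  match t with
  | Var x => HV x
  | Cst c => HC c
  | App f ts => HA f ts (fun i => term_nested_ind HV HC HA (ts i))
  end.

Section Satisfaction.
Variables (K : language) (M : model K).
Implicit Types (s : nat -> dom M) (w u : world M) (A B : form K).

Lemma eq_denote s s' t :
  (forall x, tfree x t -> s x = s' x) -> denote s t = denote s' t.
Proof.
elim/term_nested_ind: t => [x|c|f ts IH] //= ss'; first exact: ss'.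
by congr ifun; apply/ffunP => i; rewrite !ffunE; apply: IH => x xi; apply: ss'; exists i.
Qed.

Lemma eq_sat A w s s' :
  (forall x, free x A -> s x = s' x) -> sat w s A <-> sat w s' A.
Proof.
elim: A w s s' => [||R ts|B IHB C IHC|B IHB C IHC|B IHB C IHC|y B IH|y B IH]
  w s s' //= ss'.
- suff -> : [ffun i => denote s (ts i)] = [ffun i => denote s' (ts i)] by [].
  apply/ffunP => i; rewrite !ffunE; apply: eq_denote => x xi.
  by apply: ss'; exists i.
- have := IHB w s s' (fun x xB => ss' x (or_introl xB)).
  by have := IHC w s s' (fun x xC => ss' x (or_intror xC)); tauto.
- have := IHB w s s' (fun x xB => ss' x (or_introl xB)).
  by have := IHC w s s' (fun x xC => ss' x (or_intror xC)); tauto.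
- have hB u := IHB u s s' (fun x xB => ss' x (or_introl xB)).
  have hC u := IHC u s s' (fun x xC => ss' x (or_intror xC)).
  by split=> h u wu /hB/(h u wu)/hC.
- have hB b : sat w (update s y b) B <-> sat w (update s' y b) B.
    apply: IH => x xB; rewrite /update; case: eqP => // xy.
    by apply: ss'; split=> // yx; apply: xy.
  by split=> h b; apply/hB.
- have hB b : sat w (update s y b) B <-> sat w (update s' y b) B.
    apply: IH => x xB; rewrite /update; case: eqP => // xy.
    by apply: ss'; split=> // yx; apply: xy.
  by split=> -[b /hB h]; exists b.
Qed.

Lemma sat_update A w s v b :
  ~ free v A -> sat w (update s v b) A <-> sat w s A.
Proof.
move=> vA; apply: eq_sat => x xA; rewrite /update.
by case: eqP xA => // -> /vA.
Qed.

(** Atoms persist by [irel_mono], implications by transitivity of [prec]; the quantifier cases go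
    through because all worlds share one domain. *)
Lemma sat_persistent A w u s : prec w u -> sat w s A -> sat u s A.
Proof.
move=> wu; elim: A s => [||R ts|B IHB C IHC|B IHB C IHC|B _ C _|y B IH|y B IH] s //=.
- exact: irel_mono.
- by case=> /IHB hB /IHC hC.
- by case=> [/IHB|/IHC]; [left|right].
- by move=> h x ux; apply: h; apply: prec_trans wu ux.
- by move=> h b; apply: IH.
- by case=> b /IH h; exists b.
Qed.

Lemma denote_tsubst s v t r :
  denote s (tsubst v t r) = denote (update s v (denote s t)) r.
Proof.
elim/term_nested_ind: r => [x|c|f ts IH] //=.
  by rewrite /update; case: eqP.
by congr ifun; apply/ffunP => i; rewrite !ffunE.
Qed.

Lemma sat_subst A w s v t : tclosed t ->
  sat w s (subst v t A) <-> sat w (update s v (denote s t)) A.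
Proof.
move=> ct.
(* Shared by [All] and [Ex]. If [y] is [v], the update at [v] is overwritten; otherwise the two
   updates commute, since the value of the closed term [t] does not depend on [y]. *)
have under_binder B y b w' s' :
    (forall w s, sat w s (subst v t B) <-> sat w (update s v (denote s t)) B) ->
  sat w' (update s' y b) (if y == v then B else subst v t B) <->
  sat w' (update (update s' v (denote s' t)) y b) B.
  case: eqP => [->|yv] IH.
    by apply: eq_sat => x _; rewrite /update; case: eqP.
  apply: iff_trans (IH _ _) _; apply: eq_sat => x _; rewrite /update.
  case: eqP => [->|//]; case: eqP => [vy|_]; first by case: yv.
  by apply: eq_denote => z /ct.
elim: A w s => [||R ts|B IHB C IHC|B IHB C IHC|B IHB C IHC|y B IH|y B IH] w s //=.
- suff -> : [ffun i => denote s ([ffun i => tsubst v t (ts i)] i)] =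
    [ffun i => denote (update s v (denote s t)) (ts i)] by [].
  by apply/ffunP => i; rewrite !ffunE denote_tsubst.
- have := IHB w s; have := IHC w s; tauto.
- have := IHB w s; have := IHC w s; tauto.
- by split=> h u wu /IHB/(h u wu)/IHC.
- have hB b := under_binder B y b w s IH.
  by split=> h b; apply/hB.
- have hB b := under_binder B y b w s IH.
  by split=> -[b h]; exists b; apply/hB.
Qed.

End Satisfaction.

Section Soundness.
Variable L : language.
Implicit Types (M : model (plus L)) (A B C : form (plus L)).
Implicit Types (ls : seq (leaf L)).

(** For the eigenvariable rules: the value of a_i is changed, instead of a_i being renamed in a
    proof. Worlds and domain are kept, so that the same worlds and assignments serve in both
    models. *)
Definition reinterpret M (i : nat) (b : dom M) : model (plus L) :=
  {| world := world M; world_inh := world_inh M;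
     prec := @prec _ M; prec_trans := @prec_trans _ M;
     dom := dom M; dom_inh := dom_inh M;
     icst := fun c : const (plus L) =>
       if c is inr j then if j == i then b else icst M c else icst M c;
     ifun := @ifun _ M; irel := @irel _ M; irel_mono := @irel_mono _ M |}.

Lemma denote_reinterpret M i (b : dom M) (s : nat -> dom M) t :
  ~ toccurs (fresh_const L i) t ->
  denote (M := reinterpret i b) s t = denote s t.
Proof.
elim/term_nested_ind: t => [x|[c|j]|f ts IH] //= it.
  by case: eqP it => // -> [].
congr ifun; apply/ffunP => j; rewrite !ffunE.
by apply: IH => ij; apply: it; exists j.
Qed.

Lemma sat_reinterpret M i (b : dom M) A (w : world M) (s : nat -> dom M) :
  ~ occurs (fresh_const L i) A ->
  sat (M := reinterpret i b) w s A <-> sat w s A.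
Proof.
elim: A w s => [||R ts|B IHB C IHC|B IHB C IHC|B IHB C IHC|y B IH|y B IH] w s //= iA.
- suff -> : [ffun j => denote (M := reinterpret i b) s (ts j)] =
    [ffun j => denote s (ts j)] by [].
  apply/ffunP => j; rewrite !ffunE; apply: denote_reinterpret => ij.
  by apply: iA; exists j.
- have := IHB w s; have := IHC w s; tauto.
- have := IHB w s; have := IHC w s; tauto.
- have hB u := IHB u s (fun h => iA (or_introl h)).
  have hC u := IHC u s (fun h => iA (or_intror h)).
  by split=> h u wu /hB/(h u wu)/hC.
- by split=> h d; apply/IH => //; apply: h.
- by split=> -[d h]; exists d; apply/IH.
Qed.

Lemma sat_subst_fresh M i (b : dom M) v A (w : world M) (s : nat -> dom M) :
  ~ occurs (fresh_const L i) A ->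
  sat (M := reinterpret i b) w s (subst v (fresh_term L i) A) <->
  sat w (update s v b) A.
Proof.
move=> iA; apply: iff_trans (sat_subst _ _ _ _ _) _; first by move=> x.
by rewrite /= eqxx; apply: sat_reinterpret.
Qed.

(** None of these rules applies an implication at its own world, so they are sound at irreflexive
    worlds too. [sentence B] ensures that [v] is not free in the formula that leaves the scope of
    the quantifier. *)
Lemma rule1_sound A B M (w : world M) (s : nat -> dom M) :
  rule1 A B -> sentence B -> sat w s A -> sat w s B.
Proof.
case=> {A B} [A|A B|A B|A B|A B|v A B|v A B|v A t ct|v A B|v A t ct] sB /=.
- by [].
- by case.
- by case.
- by left.
- by right.
- move=> h u wu hA b; apply: (h b u wu); apply/sat_update => // vA.
  by apply: (sB v); left.
- move=> h u wu [b hA]; apply/(@sat_update _ _ _ _ _ v b); last exact: (h b u wu).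
  by move=> vB; apply: (sB v); right.
- by move=> h; apply/sat_subst.
(* Excluded middle for [A] at [w], whose truth there does not depend on the value of [v]: if [A]
   fails, every instance yields its right disjunct. *)
- move=> h; have [hA|nA] := classic (sat w s A); [by left | right=> b].
  have [hA|//] := h b; case: nA.
  by apply/(@sat_update _ _ _ _ _ v b) => // vA; apply: (sB v); left.
- by move=> /(sat_subst _ _ _ _ ct) h; exists (denote s t).
Qed.

Lemma rule2_sound A B C M (w : world M) (s : nat -> dom M) :
  rule2 A B C -> sat w s A -> sat w s B -> sat w s C.
Proof.
case=> {A B C} [A B|A B C|A B C|A B C] //= hA hB u wu.
- by move=> /(hA u wu)/(hB u wu).
- by move=> h; split; [apply: hA | apply: hB].
- by case; [apply: hA | apply: hB].
Qed.

Definition open_sat M (w u : world M) (s : nat -> dom M) ls :=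
  forall l, List.In l ls -> is_open l ->
  sat (if unsafe l then w else u) s (fml l).

Lemma open_sat_cat M (w u : world M) (s : nat -> dom M) ls1 ls2 :
  open_sat w u s (ls1 ++ ls2) -> open_sat w u s ls1 /\ open_sat w u s ls2.
Proof.
by move=> h; split=> l lls; apply: h; apply/List.in_app_iff; [left | right].
Qed.

Lemma open_sat_mark_unsafe M (w u : world M) (s : nat -> dom M) ls :
  open_sat w u s (map (@mark_unsafe L) ls) -> open_sat w w s ls.
Proof.
move=> h l lls ol; rewrite if_same.
exact: (h (mark_unsafe l) (List.in_map (@mark_unsafe L) _ _ lls) ol).
Qed.

Lemma In_discharge A ls ls' l :
  discharge A ls ls' -> List.In l ls ->
  List.In l ls' \/ l = Leaf A false false.
Proof.
elim=> {ls ls'} [|l1 l1' ls ls' [->|[-> _]] _ IH] /=; first by case.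
  by case=> [->|/IH [] h]; [left; left | left; right | right].
by case=> [->|/IH [] h]; [right | left; right | right].
Qed.

Lemma open_sat_discharge M (w u : world M) (s : nat -> dom M) A ls ls' :
  discharge A ls ls' -> sat u s A -> open_sat w u s ls' -> open_sat w u s ls.
Proof.
by move=> d hA h l /(In_discharge d) [|-> //]; apply: h.
Qed.

Lemma open_sat_persistent M (w u x : world M) (s : nat -> dom M) ls :
  prec u x -> open_sat w u s ls -> open_sat w x s ls.
Proof.
move=> ux h l lls ol; have := h l lls ol; case: (unsafe l) => //.
exact: sat_persistent.
Qed.

(** The model is quantified inside the induction, because the eigenvariable rules use the induction
    hypothesis in a reinterpreted model. *)
Lemma proof_sound ls A : proof ls A ->
  forall M (w u : world M) (s : nat -> dom M), prec w w -> prec w u ->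
  open_sat w u s ls -> sat u s A.
Proof.
elim=> {ls A}.
- by move=> A _ M w u s _ _ h; apply: (h (Leaf A false false)) => //; left.
- by [].
- move=> ls A B r sB _ IH M w u s ww wu h.
  by apply: (rule1_sound r sB); apply: IH h.
- move=> ls1 ls2 A B C r _ _ IH1 _ IH2 M w u s ww wu /open_sat_cat [h1 h2].
  by apply: (rule2_sound r); [apply: IH1 h1 | apply: IH2 h2].
- move=> ls1 ls2 A B _ IH1 _ IH2 M w u s ww wu.
  move=> /open_sat_cat [h1 /open_sat_mark_unsafe h2].
  by apply: (IH2 M w w s ww ww h2 u wu); apply: IH1 h1.
- move=> ls ls' A B _ _ IH d M w u s ww wu h x ux hA.
  apply: (IH M w x s ww); first exact: prec_trans wu ux.
  by apply: open_sat_discharge d hA _; apply: open_sat_persistent h.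
- move=> ls ls1 ls1' ls2 ls2' A B C _ IH _ IH1 d1 _ IH2 d2 M w u s ww wu.
  move=> /open_sat_cat [h /open_sat_cat [h1 h2]].
  have [hA|hB] := IH M w u s ww wu h.
    by apply: (IH1 M w u) => //; apply: open_sat_discharge d1 hA h1.
  by apply: (IH2 M w u) => //; apply: open_sat_discharge d2 hB h2.
- move=> ls v A i _ _ IH iA ils M w u s ww wu h b.
  (* a_i is made to denote the arbitrary [b]; the open assumptions avoid a_i and keep their truth
     values. *)
  apply/(@sat_subst_fresh M i b v A u s iA).
  apply: (IH (reinterpret i b) w u s ww wu) => l lls ol.
  by apply/sat_reinterpret; [apply: ils | apply: h].
- move=> ls ls1 ls1' v A i B _ IH _ IH1 iA iB ils d all_discharged M w u s ww wu.
  move=> /open_sat_cat [h h1].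
  have [b hA] := IH M w u s ww wu h.
  apply/(@sat_reinterpret M i b B u s iB).
  apply: (IH1 (reinterpret i b) w u s ww wu) => l lls ol.
  (* A leaf still open in [ls1'] differs from the instance of [A], all of whose open occurrences are
     discharged, so it avoids a_i. A newly discharged leaf is safe and holds at [u], as a_i now
     denotes the witness [b]. *)
  have [l1|->] := In_discharge d lls; last exact/sat_subst_fresh.
  apply/sat_reinterpret; last exact: h1.
  by apply: ils => //; apply: all_discharged l1 ol.
Qed.

End Soundness.

Theorem corollary1 (L : language) (Gamma : form (plus L) -> Prop)
    (phi : form (plus L))
    (hGamma : forall A, Gamma A -> sentence A) (hphi : sentence phi) :
  derivable Gamma phi -> entails Gamma phi.
Proof.
move=> [ls [p hls]] M w ww hw s.
(* With both worlds equal to [w], safe and unsafe assumptions impose the same condition. *)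
apply: (proof_sound p ww ww) => l lls ol; rewrite if_same.
exact: hw (hls l lls ol) s.
Qed.
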